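(* Let $w \in \mathcal{A}^*$ be a finite primitive word which is not a single letter. Then there exists an episturmian sequence $z$ such that every conjugate of $w$ is a factor of $z$ if and only if $w$ is a $c$-epichristoffel word.
   Context: $\mathcal{A}$ is a finite alphabet. A finite word is primitive if it is not a power $u^n$ with $n\geq 2$. Two words $w,w'$ are conjugate if $w=xy$ and $w'=yx$ for some words $x,y$. For a finite word $u$, its right palindromic closure $u^{(+)}$ is the shortest palindrome having $u$ as a prefix. An infinite word $s\in\mathcal{A}^\omega$ is a standard episturmian sequence if for every prefix $u$ of $s$, $u^{(+)}$ is also a prefix of $s$. An infinite word $t$ is an episturmian sequence if it has the same set of (finite) factors as some standard episturmian sequence. For $a,b\in\mathcal{A}$ define the morphisms of $\mathcal{A}^*$: $\psi_a(a)=\overline{\psi}_a(a)=a$; $\psi_a(x)=ax$ and $\overline{\psi}_a(x)=xa$ for $x\in\mathcal{A}\setminus\{a\}$; $\theta_{ab}$ exchanges $a$ and $b$ and fixes the other letters. The episturmian morphisms are the elements of the monoid (under composition) generated by all $\psi_a,\overline{\psi}_a,\theta_{ab}$. A finite word is $c$-epichristoffel (i.e. belongs to an epichristoffel class) if it is the image of a letter under an episturmian morphism. *)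

(* Defs.v *)
From mathcomp Require Import all_boot perm.

Set Implicit Arguments.
Unset Strict Implicit.
Unset Printing Implicit Defensive.

Section Words.
Variable A : finType.

Implicit Types (u v w : seq A) (s t : nat -> A).

Definition primitive_word w :=
  ~ exists u n, 2 <= n /\ w = flatten (nseq n u).

Definition conjugate_words w w' :=
  exists x y : seq A, w = x ++ y /\ w' = y ++ x.

Definition prefix_of u s := u = mkseq s (size u).

Definition factor_of u s := exists i, u = mkseq (fun j => s (i + j)) (size u).

Definition palindrome u := rev u == u.

(* [pal_closure u v] says that v is the right palindromic closure of u; it is
   a total functional relation by [pal_closure_ex] and [pal_closure_uniq]. *)
Definition pal_closure u v :=
  [/\ palindrome v, prefix u v &
      forall v', palindrome v' -> prefix u v' -> size v <= size v'].

Lemma pal_closure_ex u : exists v, pal_closure u v.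
Proof.
pose P k := [exists v : k.-tuple A, palindrome v && prefix u v].
have exP : exists k, P k.
  exists (size (u ++ rev u)); apply/existsP; exists (in_tuple (u ++ rev u)).
  by rewrite /palindrome rev_cat revK eqxx prefix_prefix.
case: (ex_minnP exP) => k /existsP[v /andP[pv uv]] kmin.
exists v; split=> // v' pv' uv'; rewrite size_tuple; apply: kmin.
by apply/existsP; exists (in_tuple v'); rewrite pv' uv'.
Qed.

Lemma pal_closure_uniq u v v' : pal_closure u v -> pal_closure u v' -> v = v'.
Proof.
move=> [pv uv vmin] [pv' uv' v'min].
have eqs : size v = size v' by apply/eqP; rewrite eqn_leq vmin ?v'min.
have le2 : size v <= size u + size u.
  rewrite -{2}(size_rev u) -size_cat; apply: vmin; last exact: prefix_prefix.
  by rewrite /palindrome rev_cat revK.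
have shape x : palindrome x -> prefix u x -> size x <= size u + size u ->
    x = u ++ rev (take (size x - size u) u).
  move=> /eqP px /prefixP[y xE] lex.
  rewrite xE size_cat addKn; congr (_ ++ _).
  have ley : size y <= size u by rewrite -(leq_add2l (size u)) -(size_cat u y) -xE.
  have : take (size y) (rev x) = take (size y) x by rewrite px.
  rewrite xE rev_cat take_size_cat ?size_rev // takel_cat // => <-.
  by rewrite revK.
by rewrite (shape v) // (shape v') -?eqs.
Qed.

Definition standard_episturmian s :=
  forall u v, prefix_of u s -> pal_closure u v -> prefix_of v s.

Definition episturmian t :=
  exists s, standard_episturmian s /\
            forall u, factor_of u t <-> factor_of u s.

(* The endomorphism of the free monoid extending [f] on letters. *)
Definition morph (f : A -> seq A) w : seq A := flatten (map f w).

Definition psi a := morph (fun x => if x == a then [:: a] else [:: a; x]).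
Definition psibar a := morph (fun x => if x == a then [:: a] else [:: x; a]).
Definition theta a b := morph (fun x => [:: tperm a b x]).

Inductive episturmian_morphism : (seq A -> seq A) -> Prop :=
| epi_id : episturmian_morphism id
| epi_psi a : episturmian_morphism (psi a)
| epi_psibar a : episturmian_morphism (psibar a)
| epi_theta a b : episturmian_morphism (theta a b)
| epi_comp f g : episturmian_morphism f -> episturmian_morphism g ->
    episturmian_morphism (f \o g).

Definition c_epichristoffel w :=
  exists f x, episturmian_morphism f /\ w = f [:: x].

End Words.

(* Main.v *)
(** Everything rests on [(psi a u ++ [:: a])^(+) = psi a u^(+) ++ [:: a]]: hence [psi a]
    preserves standard episturmian sequences, and conversely a standard sequence [s] with
    first letter [a] is the image under [psi a] of a standard sequence.

    If [w] is the image of a letter [x], follow [x^omega] through the generators: [psi a],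
    [psibar a] have conjugate images, so some conjugate [v] of [w] has [v^omega] standard,
    and [v^omega] contains all conjugates of [w].

    Conversely, if all conjugates of [w] occur in a standard [s], then [a = s 0] separates
    the letters of [w] cyclically, so [w] is [psi a u] or [psibar a u] with [u] shorter, and
    one inducts on [u] and the desubstituted sequence.  To make the induction go through,
    conjugates that begin and end with the first letter of the sequence are exempted. *)
Require Import Defs.
From mathcomp Require Import all_boot perm.

Set Implicit Arguments.
Unset Strict Implicit.
Unset Printing Implicit Defensive.

(** * Palindromes and palindromic closures of finite words *)

Section FiniteWords.
Variable A : finType.
Implicit Types (a x : A) (u v w y q r W : seq A).

Lemma levi u1 u2 v1 v2 : u1 ++ u2 = v1 ++ v2 -> size u1 <= size v1 ->
  exists t, v1 = u1 ++ t /\ u2 = t ++ v2.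
Proof.
elim: u1 v1 => [|x u1 IH] [|y v1] //=; first by move=> ->; exists [::].
  by move=> -> _; exists (y :: v1).
by case=> -> /IH h /h [t [-> ->]]; exists t.
Qed.

Lemma palindrome_cat u v : palindrome (u ++ v) -> size v <= size u ->
  exists q, u = rev v ++ q /\ palindrome q.
Proof.
move=> /eqP pal le; have := pal; rewrite rev_cat.
case/levi=> [|q [uE revuE]]; first by rewrite size_rev.
exists q; split=> //; move: pal; rewrite uE !rev_cat revK -catA => /eqP.
by rewrite eqseq_cat // eqxx eqseq_cat ?size_rev //= eqxx andbT.
Qed.

Lemma palindrome_closure u q : palindrome q -> palindrome (u ++ q ++ rev u).
Proof. by move=> /eqP pq; rewrite /palindrome !rev_cat revK pq catA. Qed.

(** A palindrome [u ++ t] with [t] no longer than [u] has the form [rev t ++ q ++ t], where [q] is a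
    palindromic suffix of [u]; the shortest extension comes from the longest such suffix. *)
Lemma pal_closureP u v : pal_closure u v <->
  exists y q, [/\ u = y ++ q, palindrome q, v = y ++ q ++ rev y &
    forall y' q', u = y' ++ q' -> palindrome q' -> size q' <= size q].
Proof.
split.
  move=> [pv /prefixP [t vE] vmin].
  have le_t : size t <= size u.
    have : size v <= size (u ++ rev u).
      by apply: vmin; [rewrite /palindrome rev_cat revK | exact: prefix_prefix].
    by rewrite vE !size_cat size_rev leq_add2l.
  move: pv; rewrite vE => pv; case: (palindrome_cat pv le_t) => q [uE pq].
  exists (rev t), q; split=> //; first by rewrite revK uE catA.
  move=> y' q' uE' pq'; have := vmin (y' ++ q' ++ rev y') (palindrome_closure _ pq').
  rewrite {1}uE' catA prefix_prefix => /(_ isT).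
  rewrite vE !size_cat -(size_cat y') -uE' size_rev leq_add2l => le.
  move: (congr1 size uE) (congr1 size uE'); rewrite !size_cat size_rev => -> e.
  by rewrite -(leq_add2l (size t)) e leq_add2r.
move=> [y [q [uE pq vE qmax]]]; split.
- by rewrite vE; exact: palindrome_closure.
- by rewrite vE uE catA prefix_prefix.
move=> v' pv' /prefixP [t v'E]; rewrite vE v'E catA -uE !size_cat leq_add2l size_rev.
have szu : size u = size y + size q by rewrite uE size_cat.
case: (leqP (size t) (size u)) => [le|/ltnW]; last first.
  by apply: leq_trans; rewrite szu leq_addr.
rewrite v'E in pv'; have [q' [uE' /(qmax _ _ uE')]] := palindrome_cat pv' le.
move: (congr1 size uE'); rewrite size_cat size_rev szu => e le'.
by rewrite -(leq_add2r (size q)) e leq_add2l.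
Qed.

(** * The morphisms [psi a] and [psibar a] on finite words *)

Lemma psi_cat a u v : psi a (u ++ v) = psi a u ++ psi a v.
Proof. by rewrite /psi /morph map_cat flatten_cat. Qed.

Lemma psi_cons a x w :
  psi a (x :: w) = (if x == a then [:: a] else [:: a; x]) ++ psi a w.
Proof. by []. Qed.

Lemma psibar_cat a u v : psibar a (u ++ v) = psibar a u ++ psibar a v.
Proof. by rewrite /psibar /morph map_cat flatten_cat. Qed.

Lemma psi_power a n v : psi a (flatten (nseq n v)) = flatten (nseq n (psi a v)).
Proof. by elim: n => //= n IH; rewrite psi_cat IH. Qed.

Lemma psibar_power a n v :
  psibar a (flatten (nseq n v)) = flatten (nseq n (psibar a v)).
Proof. by elim: n => //= n IH; rewrite psibar_cat IH. Qed.

Lemma psi_psibar a w : psi a w ++ [:: a] = a :: psibar a w.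
Proof.
elim: w => //= x w IH; rewrite psi_cons -catA IH /psibar /morph /=.
by case: eqP.
Qed.

Lemma size_psi a w : size w <= size (psi a w).
Proof.
elim: w => //= x w IH; rewrite psi_cons size_cat.
by case: eqP => _ /=; rewrite ?add1n ?add2n ltnS // (leq_trans IH).
Qed.

Lemma head_psi a w r : exists t, psi a w ++ a :: r = a :: t.
Proof. by case: w => [|x w]; [exists r | rewrite psi_cons; case: eqP; eexists]. Qed.

(** The image of each letter contains [a] exactly once, in first place, so every [a] here starts a
    block or is the final one. *)
Lemma psi_split a W y q : psi a W ++ [:: a] = y ++ a :: q ->
  exists W1 W2, [/\ W = W1 ++ W2, y = psi a W1 & psi a W2 ++ [:: a] = a :: q].
Proof.
elim: W y => [|x W IH] y.
  case: y => [|z y] /=; last by case: y.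
  by case=> <-; exists [::], [::].
case: y => [|z y]; first by exists [::], (x :: W).
rewrite psi_cons; case: (eqVneq x a) => [->|ne] /=.
  case=> <- /IH [W1 [W2 [-> -> ?]]]; exists (a :: W1), W2; split=> //.
  by rewrite psi_cons eqxx.
case=> <-; case: y => [|z' y] /=; first by case=> e; rewrite e eqxx in ne.
case=> <- /IH [W1 [W2 [-> -> ?]]]; exists (x :: W1), W2; split=> //.
by rewrite psi_cons (negPf ne).
Qed.

(** The [a] after [psi a v] closes its last block; without it a final [a] of [v] could match the
    first half of a block [[:: a; x]]. *)
Lemma psi_prefix a W v r : psi a W ++ [:: a] = psi a v ++ a :: r ->
  exists W', W = v ++ W'.
Proof.
elim: v W => [|x v IH] W; first by exists W.
case: W => [|y W].
  rewrite psi_cons; have [t] := head_psi a v r; case: ifP => _ /=.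
    by move=> -> [].
  by case.
rewrite !psi_cons; have [t1 e1] := head_psi a W [::]; have [t2 e2] := head_psi a v r.
case: (eqVneq y a) => [->|ney]; case: (eqVneq x a) => [->|nex] /=.
- by case=> /IH [W' ->]; exists W'.
- by rewrite e1; case=> e; rewrite e eqxx in nex.
- by rewrite e2; case=> e; rewrite e eqxx in ney.
- by case=> -> /IH [W' ->]; exists W'.
Qed.

Lemma psi_sep a W y x q : x != a -> psi a W ++ [:: a] = y ++ x :: q ->
  exists y' q', y = rcons y' a /\ q = a :: q'.
Proof.
move=> ne; elim: W y => [|z W IH] y.
  by case: y => [|? [|? ?]] //= [] e; rewrite e eqxx in ne.
rewrite psi_cons; have [t e] := head_psi a W [::].
case: ifP => _ /=; case: y => [|b y] /=; try by case=> eb; rewrite -eb eqxx in ne.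
  by case=> <- /IH [y' [q' [-> ->]]]; exists (a :: y'), q'.
case=> <-; case: y => [|c y] /=.
  by rewrite e; case=> _ <-; exists [::], t.
by case=> <- /IH [y' [q' [-> ->]]]; exists [:: a, z & y'], q'.
Qed.

Lemma rev_psi a w : rev (psi a w ++ [:: a]) = psi a (rev w) ++ [:: a].
Proof.
elim: w => //= x w IH; rewrite psi_cons -catA rev_cat IH rev_cons -cats1 psi_cat.
by rewrite -!catA; case: eqP.
Qed.

Lemma palindrome_psi a w : palindrome (psi a w ++ [:: a]) = palindrome w.
Proof.
rewrite /palindrome rev_psi; apply/eqP/eqP => [e|-> //].
case: (psi_prefix e) => t /[dup] /(congr1 size)/eqP.
rewrite size_cat size_rev -{1}[size w]addn0 eqn_add2l eq_sym size_eq0 => /eqP ->.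
by rewrite cats0.
Qed.

(** A nonempty palindromic suffix of [psi a u ++ [:: a]] ends, hence begins, with [a]. It starts at
    a block boundary and is [psi a W2 ++ [:: a]] with [W2] a palindromic suffix of [u], so the
    longest suffixes correspond. *)
Lemma pal_closure_psi a u v : pal_closure u v ->
  pal_closure (psi a u ++ [:: a]) (psi a v ++ [:: a]).
Proof.
case/pal_closureP=> y [q [uE pq vE qmax]]; apply/pal_closureP.
exists (psi a y), (psi a q ++ [:: a]); split.
- by rewrite uE psi_cat catA.
- by rewrite palindrome_psi.
- rewrite vE !psi_cat -!catA; congr (_ ++ (_ ++ _)).
  by rewrite -rev_psi rev_cat.
move=> y' q' + pq'; case: (lastP q') pq' => // q'' x /eqP pq'.
move=> e; have xa : x = a.
  by move/(congr1 (last a)): e; rewrite last_cat /= last_cat last_rcons.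
move: pq' e; rewrite {x}xa => pq'; have -> : rcons q'' a = a :: rev q''.
  by rewrite -pq' rev_rcons.
move/psi_split=> [W1 [W2 [uE' _ e2]]].
have leW : size W2 <= size q.
  apply: (qmax _ _ uE'); rewrite -(palindrome_psi a) e2 -rev_rcons.
  by rewrite /palindrome revK pq'.
rewrite -e2 !size_cat leq_add2r.
have e3 : y ++ q = W1 ++ W2 by rewrite -uE.
have [|t [_ ->]] := levi e3.
  by rewrite -(leq_add2r (size W2)) -[leqRHS]size_cat -e3 size_cat leq_add2l.
by rewrite psi_cat size_cat leq_addl.
Qed.

End FiniteWords.

(** * Infinite words: prefixes, factors and images under [psi a] *)

Section InfiniteWords.
Variable A : finType.
Implicit Types (a x : A) (u v w y p q r : seq A) (s t : nat -> A).

Lemma prefix_of_cat u v s : prefix_of (u ++ v) s <->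
  prefix_of u s /\ v = mkseq (fun j => s (size u + j)) (size v).
Proof.
have mkseqD m n : mkseq s (m + n) = mkseq s m ++ mkseq (fun j => s (m + j)) n.
  by rewrite /mkseq iotaD map_cat add0n -{2}[m]addn0 iotaDl -map_comp.
rewrite /prefix_of size_cat mkseqD; split=> [/eqP|[<- <-] //].
by rewrite eqseq_cat ?size_mkseq // => /andP [/eqP <- /eqP <-].
Qed.

Lemma prefix_of_catl u v s : prefix_of (u ++ v) s -> prefix_of u s.
Proof. by case/prefix_of_cat. Qed.

Lemma prefix_of_mkseq s n : prefix_of (mkseq s n) s.
Proof. by rewrite /prefix_of size_mkseq. Qed.

Lemma prefix_of_nth x u s i : prefix_of u s -> i < size u -> nth x u i = s i.
Proof. by move=> pu lt; rewrite pu nth_mkseq // -pu. Qed.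

Lemma prefix_of_extend u s n : prefix_of u s -> size u <= n ->
  exists q, mkseq s n = u ++ q.
Proof.
move=> -> ; rewrite size_mkseq => le.
have := prefix_of_mkseq s n; rewrite -{1}[mkseq s n](cat_take_drop (size u)).
move/prefix_of_catl; rewrite /prefix_of size_takel ?size_mkseq // => <-.
by exists (drop (size u) (mkseq s n)); rewrite cat_take_drop.
Qed.

Lemma factor_ofP v s : factor_of v s <-> exists p, prefix_of (p ++ v) s.
Proof.
split=> [[i vE]|[p /prefix_of_cat [_ vE]]]; last by exists (size p).
exists (mkseq s i); apply/prefix_of_cat; rewrite size_mkseq.
by split=> //; exact: prefix_of_mkseq.
Qed.

Lemma factor_of_infix p v q s : factor_of (p ++ v ++ q) s -> factor_of v s.
Proof.
case/factor_ofP=> r; rewrite !catA => /prefix_of_catl h.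
by apply/factor_ofP; exists (r ++ p).
Qed.

(** The extension of [psi a] to infinite words, as a relation: by [size_psi] the images of prefixes
    are unboundedly long, hence determine [t]. *)
Definition psi_image a s t := forall n, prefix_of (psi a (mkseq s n)) t.

Lemma psi_image_rcons a s t u :
  psi_image a s t -> prefix_of u s -> prefix_of (psi a u ++ [:: a]) t.
Proof.
move=> im ->; have := im (size u).+1.
rewrite mkseqS -cats1 psi_cat psi_cons catA; case: ifP => _ /prefix_of_catl //.
by rewrite -cat1s catA => /prefix_of_catl.
Qed.

Lemma psi_image_extend a s t r : psi_image a s t -> prefix_of r t ->
  exists n q, psi a (mkseq s n) ++ [:: a] = r ++ q.
Proof.
move=> im pr; exists (size r).
have p2 := psi_image_rcons im (prefix_of_mkseq s (size r)).
rewrite p2; apply: prefix_of_extend => //.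
by rewrite size_cat (leq_trans _ (leq_addr _ _)) // -{1}(size_mkseq s (size r)) size_psi.
Qed.

Lemma psi_image_prefix a s t v :
  psi_image a s t -> prefix_of (psi a v ++ [:: a]) t -> prefix_of v s.
Proof.
move=> im /(psi_image_extend im) [n [q]]; rewrite -catA => /psi_prefix [W e].
by have := prefix_of_mkseq s n; rewrite e => /prefix_of_catl.
Qed.

Lemma psi_image_factor a s t v :
  psi_image a s t -> factor_of (psi a v ++ [:: a]) t -> factor_of v s.
Proof.
move=> im /factor_ofP [p /(psi_image_extend im) [n [q]]]; rewrite -!catA.
have [r e] := head_psi a v q; rewrite /= e => /psi_split [W1 [W2 [e1 _]]].
rewrite -e => /psi_prefix [W e2]; apply/factor_ofP; exists W1.
have := prefix_of_mkseq s n; rewrite e1 e2 catA; exact: prefix_of_catl.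
Qed.

Lemma psi_image0 a s t : psi_image a s t -> t 0 = a.
Proof.
move=> im; have := psi_image_rcons im (u := [::]) erefl; rewrite /prefix_of /=.
by case.
Qed.

(** For prefixes ending in [a] this is [pal_closure_psi]. A prefix ending in another letter is
    followed by [a], and appending that [a] does not change the closure. *)
Lemma standard_psi a s t :
  psi_image a s t -> standard_episturmian s -> standard_episturmian t.
Proof.
move=> im st; have closed_a u : prefix_of (rcons u a) t -> forall v,
    pal_closure (rcons u a) v -> prefix_of v t.
  move=> pu v clv; have [n [q]] := psi_image_extend im pu.
  rewrite cat_rcons => /psi_split [W1 [W2 [e eu _]]].
  have [v1 clv1] := pal_closure_ex W1.
  have := pal_closure_psi a clv1; rewrite -eu cats1 => /(pal_closure_uniq clv) ->.
  apply: (psi_image_rcons im); apply: (st W1) => //.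
  by have := prefix_of_mkseq s n; rewrite e => /prefix_of_catl.
move=> u v; case: (lastP u) => [_ [_ _ /(_ [::] erefl erefl)]|{}u x].
  by rewrite leqn0 size_eq0 => /eqP ->.
case: (eqVneq x a) => [-> pu cl|ne pu cl]; first exact: closed_a cl.
have [n [q e]] := psi_image_extend im pu.
have pua : prefix_of (rcons u x ++ [:: a]) t.
  have := psi_image_rcons im (prefix_of_mkseq s n); move: e; rewrite cat_rcons => e.
  have [_ [q' [_ e']]] := psi_sep ne e; rewrite e e' -cat_rcons -cat1s catA.
  exact: prefix_of_catl.
apply: (closed_a (rcons u x)); first by rewrite -cats1.
case: (cl) => pv _ vmin; split=> //; last first.
  by move=> v' pv' pre; apply: vmin => //; apply: prefix_trans pre; exact: prefix_rcons.
(* The longest palindromic suffix [z] starts with [x], so [y] ends with [a] by [psi_sep], and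
   [v = y ++ z ++ rev y] has an [a] right after [rcons u x]. *)
have /pal_closureP [y [z [uE pz vE zmax]]] := cl.
case: (lastP z) uE pz vE zmax => [|z1 c] uE pz vE zmax.
  by have := zmax u [:: x]; rewrite cats1 => /(_ erefl (eqxx _)).
move: uE; rewrite -rcons_cat => /rcons_inj [uE xc]; move: pz vE zmax; rewrite -{c}xc.
move=> pz vE _; have zE : rcons z1 x = x :: rev z1 by rewrite -(eqP pz) rev_rcons.
move: e; rewrite uE rcons_cat zE -catA => /(psi_sep ne) [y' [_ [yE _]]].
apply/prefixP; exists (rev y').
by rewrite vE [in rev y]yE rev_rcons zE cat_rcons -catA.
Qed.

(** In the closure of the prefix of length [i.+1], the next letter mirrors the letter [d] just
    before the longest palindromic suffix, which itself starts with [s i]. If [d] were not [s 0],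
    induction would give [s i = s 0]. *)
Lemma standard_sep s i : standard_episturmian s -> s i != s 0 -> s i.+1 = s 0.
Proof.
move=> st; elim/ltn_ind: i => i IH ne.
have [v cl] := pal_closure_ex (mkseq s i.+1).
have pv := st _ _ (prefix_of_mkseq s _) cl.
have /pal_closureP [y [z [uE pz vE zmax]]] := cl.
case: (lastP z) uE pz vE zmax => [|z1 c] uE pz vE zmax.
  by have := zmax (mkseq s i) [:: s i]; rewrite cats1 mkseqS => /(_ erefl (eqxx _)).
have cE : c = s i.
  by move: uE; rewrite mkseqS -rcons_cat => /rcons_inj [].
have zE : rcons z1 c = c :: rev z1 by rewrite -(eqP pz) rev_rcons.
have nth_s k : k < size v -> nth (s 0) v k = s k.
  exact: prefix_of_nth.
have szu : size y + (size z1).+1 = i.+1.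
  by rewrite -(size_mkseq s i.+1) uE size_cat size_rcons.
have sy : s (size y) = s i.
  rewrite -nth_s; last by rewrite vE !size_cat size_rcons addSn addnS ltnS leq_addr.
  by rewrite vE nth_cat ltnn subnn zE /= cE.
case: (lastP y) uE vE szu sy => [|y1 d] uE vE szu sy; first by rewrite -sy /= eqxx in ne.
rewrite size_rcons in szu sy.
have lt : size y1 < i by rewrite -ltnS -szu addnS ltnS addSn ltnS leq_addr.
have szv : size v = i.+1 + (size y1).+1.
  by rewrite vE catA size_cat -uE size_mkseq size_rev size_rcons.
have s1 : s (size y1) = d.
  rewrite -nth_s; last by rewrite szv addnS ltnS leq_addl.
  by rewrite vE nth_cat size_rcons ltnSn nth_rcons ltnn eqxx.
have <- : d = s i.+1.
  rewrite -nth_s; last by rewrite szv addnS ltnS leq_addr.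
  by rewrite vE catA -uE nth_cat size_mkseq ltnn subnn rev_rcons.
apply/eqP; rewrite -s1; apply: contraT => /(IH _ lt) e.
by rewrite -sy e eqxx in ne.
Qed.

Lemma standard_desubst s : standard_episturmian s ->
  exists s', psi_image (s 0) s' s /\ standard_episturmian s'.
Proof.
move=> st; set a := s 0.
pose pos n := iter n (fun i => if s i.+1 == a then i.+1 else i.+2) 0.
pose s' n := s (pos n).+1.
have pos_a n : s (pos n) = a.
  elim: n => //= n IH; case: ifP => [/eqP //|/negbT]; exact: standard_sep.
have imn n : psi a (mkseq s' n) = mkseq s (pos n).
  elim: n => // n IH; rewrite mkseqS -cats1 psi_cat IH psi_cons /= /s'.
  case: eqP => _; rewrite !mkseqS pos_a ?cats1 //.
  by rewrite -[rcons (rcons _ _) _]cats1 cat_rcons.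
have im : psi_image a s' s by move=> n; rewrite imn; exact: prefix_of_mkseq.
exists s'; split=> // u v pu cl.
apply: (psi_image_prefix im); apply: (st _ _ _ (pal_closure_psi a cl)).
exact: psi_image_rcons pu.
Qed.

End InfiniteWords.

(** * Conjugacy and periodic standard sequences *)

Section Conjugates.
Variable A : finType.
Implicit Types (a b x : A) (u v w p q r : seq A) (s t : nat -> A).

Lemma conjugate_wordsP w w' : conjugate_words w w' <-> exists i, w' = rot i w.
Proof.
split=> [[x [y [-> ->]]]|[i ->]]; first by exists (size x); rewrite rot_size_cat.
by exists (take i w), (drop i w); rewrite cat_take_drop.
Qed.

Lemma conjugate_words_trans u v w :
  conjugate_words u v -> conjugate_words v w -> conjugate_words u w.
Proof.
move=> /conjugate_wordsP [i ->] /conjugate_wordsP [j ->].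
by apply/conjugate_wordsP; rewrite rot_rot_add; eexists.
Qed.

Lemma conjugate_words_sym u v : conjugate_words u v -> conjugate_words v u.
Proof. by move=> [x [y [-> ->]]]; exists y, x. Qed.

Lemma conjugate_words_refl u : conjugate_words u u.
Proof. by exists [::], u; rewrite cats0. Qed.

Lemma conjugate_psi a u v :
  conjugate_words u v -> conjugate_words (psi a u) (psi a v).
Proof. by move=> [x [y [-> ->]]]; exists (psi a x), (psi a y); rewrite !psi_cat. Qed.

Lemma conjugate_psi_psibar a u : conjugate_words (psi a u) (psibar a u).
Proof.
have := psi_psibar a u; case: (psi a u) => [[<-]|x t /= [-> <-]].
  exact: conjugate_words_refl.
by exists [:: a], t.
Qed.

Lemma conjugate_map (f : A -> A) u v :
  conjugate_words u v -> conjugate_words (map f u) (map f v).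
Proof. by move=> [x [y [-> ->]]]; exists (map f x), (map f y); rewrite !map_cat. Qed.

Lemma thetaE a b w : theta a b w = map (tperm a b) w.
Proof. exact: flatten_map1. Qed.

Lemma prefix_of_map (f : A -> A) u s : prefix_of u s -> prefix_of (map f u) (f \o s).
Proof. by rewrite /prefix_of size_map => {1}->; rewrite /mkseq -map_comp. Qed.

Lemma standard_map (f : A -> A) s :
  involutive f -> standard_episturmian s -> standard_episturmian (f \o s).
Proof.
move=> fK st u v pu [pv uv vmin]; have mapK := mapK fK.
have pal w : palindrome (map f w) = palindrome w.
  by rewrite /palindrome -map_rev (inj_eq (inj_map (inv_inj fK))).
have pre w w' : prefix (map f w) (map f w') = prefix w w'.
  by rewrite !prefixE size_map -map_take (inj_eq (inj_map (inv_inj fK))).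
rewrite -[v]mapK; apply: prefix_of_map; apply: (st (map f u)).
  have := prefix_of_map f pu; rewrite /prefix_of => {1}->; apply: eq_mkseq => i /=.
  exact: fK.
split; rewrite ?pal ?pre // => v' pv' uv'; rewrite size_map -(size_map f v').
by apply: vmin; rewrite ?pal // -[u]mapK pre.
Qed.

Lemma periodic_word v : v != [::] ->
  exists s, forall n, prefix_of (flatten (nseq n v)) s.
Proof.
case: v => // x v _; set z := x :: v.
exists (fun i => nth x z (i %% size z)); elim=> //= n IH.
rewrite -[x :: v ++ _]/(z ++ _); apply/prefix_of_cat; split.
  apply: (@eq_from_nth _ x); rewrite ?size_mkseq // => i lt.
  by rewrite nth_mkseq // modn_small.
by rewrite {1}IH; apply: eq_mkseq => i; rewrite modnDl.
Qed.

(** The invariant carried from a letter through the generators. Only some conjugate [v] of [u] is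
    asked to have [v^omega] standard, since [psibar a u] is merely conjugate to [psi a u]. *)
Definition periodic_standard u := exists v s,
  [/\ conjugate_words u v, v != [::], standard_episturmian s
    & forall n, prefix_of (flatten (nseq n v)) s].

Lemma periodic_standard_letter x : periodic_standard [:: x].
Proof.
have [//|s ps] := @periodic_word [:: x].
exists [:: x], s; split=> //; first exact: conjugate_words_refl.
have mk n : mkseq s n = nseq n x.
  have := ps n; rewrite /prefix_of.
  have -> : flatten (nseq n [:: x]) = nseq n x by elim: n => //= n ->.
  by rewrite size_nseq.
(* Every prefix of [x^omega] is a palindrome, hence its own closure. *)
move=> u v pu [pv uv vmin]; suff -> : v = u by [].
have pal_u : palindrome u by rewrite pu mk /palindrome rev_nseq.
have := vmin u pal_u (prefix_refl u); case/prefixP: uv => r ->.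
by rewrite size_cat -{2}[size u]addn0 leq_add2l leqn0 size_eq0 => /eqP ->; rewrite cats0.
Qed.

Lemma periodic_standard_psi a u : periodic_standard u -> periodic_standard (psi a u).
Proof.
case=> v [s [cuv v0 st ps]].
have v0' : psi a v != [::] by rewrite -size_eq0 -lt0n (leq_trans _ (size_psi a v)) ?lt0n ?size_eq0.
have [t pt] := periodic_word v0'.
exists (psi a v), t; split=> //; first exact: conjugate_psi.
apply: (standard_psi (a := a) (s := s)) => // n.
have le : size (mkseq s n) <= size (flatten (nseq n v)).
  rewrite size_mkseq size_flatten /shape map_nseq sumn_nseq leq_pmull //.
  by rewrite lt0n size_eq0.
have [q e] := prefix_of_extend (prefix_of_mkseq s n) le.
have := pt n; rewrite -psi_power (ps n) e psi_cat; exact: prefix_of_catl.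
Qed.

Lemma periodic_standard_conjugate u v :
  conjugate_words u v -> periodic_standard u -> periodic_standard v.
Proof.
move=> cuv [w [s [cuw w0 st ps]]]; exists w, s; split=> //.
exact: conjugate_words_trans (conjugate_words_sym cuv) cuw.
Qed.

Lemma periodic_standard_morphism f u :
  episturmian_morphism f -> periodic_standard u -> periodic_standard (f u).
Proof.
move=> ef; elim: ef u => {f} [|a|a|a b|f g _ IHf _ IHg] u // pu.
- exact: periodic_standard_psi.
- apply: (periodic_standard_conjugate (conjugate_psi_psibar a u)).
  exact: periodic_standard_psi.
- case: pu => v [s [cuv v0 st ps]].
  exists (map (tperm a b) v), (tperm a b \o s); rewrite thetaE; split.
  + exact: conjugate_map.
  + by rewrite -size_eq0 size_map size_eq0.
  + by apply: standard_map => //; exact: tpermK.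
  by move=> n; rewrite -map_nseq -map_flatten; exact: prefix_of_map.
by apply: IHf; exact: IHg.
Qed.

(** * Separation of letters by [s 0], and its consequence for factors *)

Lemma standard_factor_next s v x : standard_episturmian s -> x != s 0 ->
  factor_of (rcons v x) s -> factor_of (rcons v x ++ [:: s 0]) s.
Proof.
move=> st ne [i]; rewrite size_rcons mkseqS => /rcons_inj [vE xE].
exists i; rewrite size_cat size_rcons addn1 !mkseqS cats1 -vE -xE.
by rewrite addnS standard_sep // -xE.
Qed.

(** A letter precedes [x] because [x] is not [s 0]; if that letter were not [s 0], [standard_sep]
    would make [x] equal to [s 0]. *)
Lemma standard_factor_prev s v x : standard_episturmian s -> x != s 0 ->
  factor_of (x :: v) s -> factor_of (s 0 :: x :: v) s.
Proof.
move=> st ne /factor_ofP [p]; case: (lastP p) => [|{}p c].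
  by rewrite /prefix_of /= => -[e]; rewrite e eqxx in ne.
rewrite cat_rcons => pc; apply/factor_ofP; exists p; suff <- : c = s 0 by [].
have lt : (size p).+1 < size (p ++ [:: c, x & v]).
  by rewrite size_cat /= !addnS !ltnS leq_addr.
have cE : c = s (size p).
  by rewrite -(prefix_of_nth c pc) ?(ltnW lt) // nth_cat ltnn subnn.
have xE : x = s (size p).+1.
  by rewrite -(prefix_of_nth c pc) // nth_cat ltnNge leqnSn subSnn.
apply/eqP; rewrite cE; apply: contraT => /(standard_sep st) e0.
by rewrite xE e0 eqxx in ne.
Qed.

Lemma standard_factor2 s b c : standard_episturmian s ->
  factor_of [:: b; c] s -> (b == s 0) || (c == s 0).
Proof.
move=> st [i [-> ->]]; rewrite addn0 addn1; case: eqVneq => //= ne.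
by rewrite standard_sep.
Qed.

(** Cutting before each [a] leaves only blocks [[:: a]] and [[:: a; x]], as no two adjacent letters
    both differ from [a]. *)
Lemma psi_decomp a w :
  (forall p b c r, a :: w = p ++ [:: b, c & r] -> (b == a) || (c == a)) ->
  exists u, a :: w = psi a u.
Proof.
have [n] := ubnP (size w); elim: n w => // n IH w; rewrite ltnS.
case: w => [|c w] /= lt sep; first by exists [:: a]; rewrite psi_cons eqxx.
case: (eqVneq c a) => [ca|ne].
  have [||u uE] := IH w; rewrite ?ca //.
    by move=> p b d r e; apply: (sep (a :: p) b d r); rewrite ca e.
  by exists (a :: u); rewrite psi_cons eqxx uE.
case: w lt sep => [|d w] lt sep; first by exists [:: c]; rewrite psi_cons (negPf ne).
have := sep [:: a] c d w erefl; rewrite (negPf ne) => /eqP /= da.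
have [||u uE] := IH w; first exact: ltnW.
  by move=> p b d' r e; apply: (sep [:: a, c & p] b d' r); rewrite da e.
by exists (c :: u); rewrite psi_cons (negPf ne) /= -uE da.
Qed.

Lemma psi_nontrivial a u : has (predC1 a) u -> size u < size (psi a u).
Proof.
elim: u => //= x u IH; rewrite psi_cons size_cat /=.
by case: eqVneq => //= _; rewrite ?add1n ?add2n !ltnS ?size_psi.
Qed.

End Conjugates.

(** * Desubstitution of words whose conjugates occur *)

Section Main.
Variable A : finType.
Implicit Types (a b x : A) (u v w p q r : seq A) (s : nat -> A).

(* The exemption is needed because an occurrence of [psi a (rcons v a)] in the image of
   [s] under [psi a] may come from [rcons v b] with [b != a]. *)
Definition conjugates_occur w s := forall w', conjugate_words w w' ->
  (head (s 0) w' != s 0) || (last (s 0) w' != s 0) -> factor_of w' s.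

Lemma primitive_preimage (f : seq A -> seq A) u :
  (forall n v, f (flatten (nseq n v)) = flatten (nseq n (f v))) ->
  primitive_word (f u) -> primitive_word u.
Proof.
by move=> fX prim [v [n [n2 uE]]]; apply: prim; exists (f v), n; rewrite uE fX.
Qed.

(** A word made of [a] alone is a proper power or has an image of length at most one. The other
    letter makes [psi a] strictly lengthen [u], so that the induction descends. *)
Lemma primitive_has_other a u : primitive_word u -> 1 < size (psi a u) ->
  has (predC1 a) u.
Proof.
move=> prim; apply: contraTT; rewrite has_predC negbK => /all_pred1P uE.
case: (ltnP 1 (size u)) => [n2|].
  case: prim; exists [:: a], (size u); split=> //; rewrite {1}uE.
  by elim: (size u) => //= n ->.
by rewrite uE size_nseq; case: (size u) => [|[|n]] // _; rewrite /= psi_cons eqxx.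
Qed.

Lemma conjugates_decomp a s w : standard_episturmian s -> a = s 0 ->
  conjugates_occur w s -> 1 < size w ->
  exists u, w = psi a u \/ w = psibar a u.
Proof.
move=> st aE occ w2.
(* Two cyclically adjacent letters of [w] begin a conjugate. If the first is not [a], this conjugate
   is not exempt, so it occurs in [s]. *)
have sep b c r : conjugate_words w [:: b, c & r] -> (b == a) || (c == a).
  move=> cj; case: (eqVneq b a) => //= ne.
  have := occ _ cj; rewrite /= -aE ne => /(_ isT).
  rewrite -[[:: b, c & r]]/([::] ++ [:: b; c] ++ r) => /factor_of_infix.
  by move/(standard_factor2 st); rewrite -aE (negPf ne).
have dec w1 : conjugate_words w (a :: w1) -> exists u, a :: w1 = psi a u.
  move=> cj; apply: psi_decomp => p b c r e; apply: (sep b c (r ++ p)).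
  apply: (conjugate_words_trans cj); rewrite e.
  by exists p, [:: b, c & r].
case: w w2 sep occ dec => // x w w2 sep occ dec.
case: (eqVneq x a) => [xa|ne].
  have [|u] := dec w; first by rewrite xa; exact: conjugate_words_refl.
  by exists u; left; rewrite xa.
case: (lastP w) w2 sep occ dec => // {}w y w2 sep occ dec.
(* Since [x] is not [a], its cyclic predecessor [y] is. Moving it to the front gives an image under
   [psi a], which [psi_psibar] turns into one under [psibar a]. *)
have cj : conjugate_words (x :: rcons w y) (y :: x :: w).
  by exists (x :: w), [:: y]; rewrite -cats1.
have := sep _ _ _ cj; rewrite (negPf ne) orbF => /eqP ya; rewrite ya in cj dec *.
have [u uE] := dec _ cj.
by exists u; right; have := psi_psibar a u; rewrite -uE /= cats1 => -[].
Qed.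

(** It suffices to find [psi a v ++ [:: a]] in [s]. If [v] ends with a letter other than [a], so
    does [psi a v], which occurs and is followed by [a]. Otherwise [v] starts with such a letter and
    [psibar a v] occurs, preceded by [a]. *)
Lemma conjugates_desubst a s s' u : standard_episturmian s -> psi_image a s' s ->
  conjugates_occur (psi a u) s ->
  forall v, conjugate_words u v -> (head a v != a) || (last a v != a) ->
    factor_of v s'.
Proof.
move=> st im occ v cuv ne; have s0 := psi_image0 im.
apply: (psi_image_factor im).
have cj := conjugate_psi a cuv.
case: (lastP v) ne cuv cj => [|v' z] /=; first by rewrite eqxx.
rewrite last_rcons; case: (eqVneq z a) => [->|nez] ne cuv cj.
  rewrite orbF in ne; rewrite psi_psibar.
  case: v' ne cuv cj => [|y v'] /=; first by rewrite eqxx.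
  move=> ne cuv cj.
  have pE : psibar a (y :: rcons v' a) = y :: a :: psibar a (rcons v' a).
    by rewrite /psibar /morph /= (negPf ne).
  rewrite pE -s0; apply: standard_factor_prev; rewrite ?s0 // -pE.
  apply: occ; last by rewrite s0 pE /= ne.
  apply: conjugate_words_trans cj _; exact: conjugate_psi_psibar.
have [q qE] : exists q, psi a (rcons v' z) = rcons q z.
  exists (rcons (psi a v') a); rewrite -!cats1 psi_cat psi_cons (negPf nez) /=.
  by rewrite -catA.
rewrite qE -{1}s0; apply: standard_factor_next; rewrite ?s0 //.
by rewrite -qE; apply: occ => //; rewrite s0 qE last_rcons nez orbT.
Qed.

Lemma conjugates_occur_desubst a s s' u :
    standard_episturmian s -> standard_episturmian s' -> psi_image a s' s ->
    has (predC1 a) u -> conjugates_occur (psi a u) s ->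
  conjugates_occur u s'.
Proof.
move=> st st' im /hasP [b bu /= ne] occ v cuv cond.
have K := conjugates_desubst st im occ.
have bv : b \in v.
  by case/conjugate_wordsP: cuv => i ->; rewrite mem_rot.
(* [v] contains [b], so the default values of [head] and [last] do not matter. *)
have v_ne x y : (head x v = head y v) * (last x v = last y v) by case: (v) bv.
rewrite !(v_ne (s' 0) a) in cond.
case: (boolP ((head a v != a) || (last a v != a))) => [|]; first exact: K.
(* Remaining case: [v] begins and ends with [a], and [a] is not [s' 0]. Rotating [v] to start at [b]
   makes [[:: a; a]] a factor of [s'], against [standard_factor2]. *)
rewrite negb_or !negbK => /andP [/eqP hv /eqP lv]; rewrite hv lv orbb in cond.
case/splitPr: {v_ne} bv hv lv cuv => p r.
rewrite last_cat /=; case: p => [/= ba|c p /= -> lr cuv].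
  by rewrite ba eqxx in ne.
case: (lastP r) lr cuv => [/= ba|{}r d]; first by rewrite ba eqxx in ne.
rewrite last_rcons => -> cuv.
have /K : conjugate_words u ([:: b] ++ r ++ [:: a; a] ++ p).
  apply: (conjugate_words_trans cuv); exists (a :: p), (b :: rcons r a).
  by rewrite -cats1 /= -catA.
rewrite /= ne => /(_ isT) h.
have : factor_of [:: a; a] s' by exact: (@factor_of_infix _ (b :: r) [:: a; a] p).
by move/(standard_factor2 st'); rewrite orbb (negPf cond).
Qed.

Lemma conjugates_occur_epichristoffel s w : standard_episturmian s ->
  primitive_word w -> conjugates_occur w s -> c_epichristoffel w.
Proof.
have [n] := ubnP (size w); elim: n w s => // n IH w s; rewrite ltnS.
case: w => [|x [|y w]] le st prim occ.
(* The empty word is its own square. *)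
- by case: prim; exists [::], 2.
- by exists id, x; split=> //; exact: epi_id.
move: {x y w}[:: x, y & w] (isT : 1 < size [:: x, y & w]) le prim occ => w w2 le prim occ.
have [s' [im st']] := standard_desubst st.
have [u wE] := conjugates_decomp st erefl occ w2.
set a := s 0 in im wE.
have cj : conjugate_words w (psi a u).
  case: wE => ->; first exact: conjugate_words_refl.
  by apply: conjugate_words_sym; exact: conjugate_psi_psibar.
have szw : size w = size (psi a u).
  by case/conjugate_wordsP: cj => i ->; rewrite size_rot.
have prim_u : primitive_word u.
  case: wE prim => ->; apply: primitive_preimage => k v;
    [exact: psi_power | exact: psibar_power].
have other : has (predC1 a) u by apply: primitive_has_other; rewrite // -szw.
have occ' : conjugates_occur (psi a u) s.
  by move=> w' cj'; apply: occ; exact: conjugate_words_trans cj cj'.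
have lt : size u < n by apply: leq_trans le; rewrite szw psi_nontrivial.
have [f [x [ef uE]]] :=
  IH u s' lt st' prim_u (conjugates_occur_desubst st st' im other occ').
case: wE => ->; rewrite uE.
  by exists (psi a \o f), x; split=> //; apply: epi_comp => //; exact: epi_psi.
by exists (psibar a \o f), x; split=> //; apply: epi_comp => //; exact: epi_psibar.
Qed.

Lemma periodic_standard_factors u : periodic_standard u ->
  exists s, standard_episturmian s /\
    forall w, conjugate_words u w -> factor_of w s.
Proof.
case=> v [s [cuv v0 st ps]]; exists s; split=> // w cuw.
have [x [y [vE ->]]] := conjugate_words_trans (conjugate_words_sym cuv) cuw.
(* The square of [v = x ++ y] is [x ++ (y ++ x) ++ y]. *)
apply: (factor_of_infix (p := x) (q := y)); apply/factor_ofP; exists [::].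
by have := ps 2; rewrite /= cats0 vE -!catA.
Qed.

End Main.

Theorem theorem6p2 (A : finType) (w : seq A)
    (w_primitive : primitive_word w) (w_not_letter : forall a : A, w <> [:: a]) :
  (exists z : nat -> A, episturmian z /\
     forall w' : seq A, conjugate_words w w' -> factor_of w' z)
  <-> c_epichristoffel w.
Proof.
split=> [[z [[s [st zs]] occ]]|[f [x [ef wE]]]].
  apply: (conjugates_occur_epichristoffel st w_primitive) => w' cj _.
  by apply/zs; exact: occ.
have [s [st occ]] := periodic_standard_factors
  (periodic_standard_morphism ef (periodic_standard_letter x)).
exists s; split; first by exists s; split=> // u; split.
by rewrite wE.
Qed.
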